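(* Let $R>0$ and let $f$ be a slice regular function on $B=B(0,R)$ such that $f(0)=0$. Then $$|q^{-1}f(q)|\le\|\partial_C f\|$$ for all $q\in B\setminus\{0\}$.
   Context: $\mathbb{H}$ is the skew field of quaternions; $B(0,R)=\{q\in\mathbb{H}:|q|<R\}$; $\mathbb{S}=\{q\in\mathbb{H}:q^2=-1\}$; for $I\in\mathbb{S}$, $L_I=\mathbb{R}+\mathbb{R}I$ and $B_I=B\cap L_I$. A function $f:B\to\mathbb{H}$ is slice regular if for every $I\in\mathbb{S}$ its restriction $f_I$ to $B_I$ has continuous partial derivatives and satisfies $\frac12\left(\frac{\partial}{\partial x}+I\frac{\partial}{\partial y}\right)f_I(x+yI)=0$ on $B_I$; equivalently, $f(q)=\sum_{n\ge0}q^na_n$ is a convergent power series on $B$ with $a_n\in\mathbb{H}$. The slice derivative is $\partial_C f(x+yI)=\frac{\partial}{\partial x}f(x+yI)$, i.e. $\partial_Cf(q)=\sum_{n\ge1}q^{n-1}na_n$; it is again slice regular on $B$. Norm: for a slice regular $g:B\to\mathbb{H}$, $I\in\mathbb{S}$, and $J\in\mathbb{S}$ orthogonal to $I$, there are unique holomorphic functions $F,G:B_I\to L_I$ with $g(z)=F(z)+G(z)J$ for all $z\in B_I$. Set $\|g\|_I=\left(\sup_{B_I}|F|^2+\sup_{B_I}|G|^2\right)^{1/2}$ (independent of $J$) and $\|g\|=\sup_{I\in\mathbb{S}}\|g\|_I\in[0,+\infty]$. *)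

(* Defs.v *)
From HB Require Import structures.
From mathcomp Require Import all_boot all_order all_algebra ring lra.
From mathcomp Require Import all_classical all_reals all_analysis.
Set Implicit Arguments.
Unset Strict Implicit.
Unset Printing Implicit Defensive.
Import Order.TTheory GRing.Theory Num.Theory.
Import numFieldNormedType.Exports.
Local Open Scope classical_set_scope.
Local Open Scope ring_scope.

Record quat (R : Type) : Type := Quat { qre : R; qi : R; qj : R; qk : R }.

Section QuatChoice.
Variable R : Type.
Definition seq_of_quat (q : quat R) := [:: qre q; qi q; qj q; qk q].
Definition quat_of_seq (s : seq R) :=
  if s is [:: a; b; c; d] then Some (Quat a b c d) else None.
Lemma seq_of_quatK : pcancel seq_of_quat quat_of_seq.
Proof. by case. Qed.
End QuatChoice.

HB.instance Definition _ (R : eqType) := Equality.copy (quat R)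
  (pcan_type (@seq_of_quatK R)).
HB.instance Definition _ (R : choiceType) := Choice.copy (quat R)
  (pcan_type (@seq_of_quatK R)).

Section QuatAlgebra.
Variable R : realType.
Implicit Types p q : quat R.

Lemma quat_eqP p q :
  [/\ qre p = qre q, qi p = qi q, qj p = qj q & qk p = qk q] -> p = q.
Proof. by case: p => a b c d; case: q => a' b' c' d' /= [-> -> -> ->]. Qed.

Definition addq p q :=
  Quat (qre p + qre q) (qi p + qi q) (qj p + qj q) (qk p + qk q).
Definition oppq p := Quat (- qre p) (- qi p) (- qj p) (- qk p).

Program Definition quat_zmod := @GRing.isZmodule.Build (quat R)
  (Quat 0 0 0 0) oppq addq _ _ _ _.
Next Obligation. by move=> p q s; apply: quat_eqP; split=> /=; ring. Qed.
Next Obligation. by move=> p q; apply: quat_eqP; split=> /=; ring. Qed.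
Next Obligation. by move=> p; apply: quat_eqP; split=> /=; ring. Qed.
Next Obligation. by move=> p; apply: quat_eqP; split=> /=; ring. Qed.
HB.instance Definition _ := quat_zmod.

Definition mulq p q :=
  Quat (qre p * qre q - qi p * qi q - qj p * qj q - qk p * qk q)
       (qre p * qi q + qi p * qre q + qj p * qk q - qk p * qj q)
       (qre p * qj q - qi p * qk q + qj p * qre q + qk p * qi q)
       (qre p * qk q + qi p * qj q - qj p * qi q + qk p * qre q).

Program Definition quat_ring := @GRing.Zmodule_isNzRing.Build (quat R)
  (Quat 1 0 0 0) mulq _ _ _ _ _ _.
Next Obligation. by move=> p q s; apply: quat_eqP; split=> /=; ring. Qed.
Next Obligation. by move=> p; apply: quat_eqP; split=> /=; ring. Qed.
Next Obligation. by move=> p; apply: quat_eqP; split=> /=; ring. Qed.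
Next Obligation. by move=> p q s; apply: quat_eqP; split=> /=; ring. Qed.
Next Obligation. by move=> p q s; apply: quat_eqP; split=> /=; ring. Qed.
Next Obligation.
by apply/eqP => -[] /eqP; rewrite oner_eq0.
Qed.
HB.instance Definition _ := quat_ring.

Definition scaleq (a : R) q := Quat (a * qre q) (a * qi q) (a * qj q) (a * qk q).

Program Definition quat_lmod := @GRing.Zmodule_isLmodule.Build R (quat R)
  scaleq _ _ _ _.
Next Obligation. by move=> a b p; apply: quat_eqP; split=> /=; ring. Qed.
Next Obligation. by move=> p; apply: quat_eqP; split=> /=; ring. Qed.
Next Obligation. by move=> a p q; apply: quat_eqP; split=> /=; ring. Qed.
Next Obligation. by move=> p a b; apply: quat_eqP; split=> /=; ring. Qed.
HB.instance Definition _ := quat_lmod.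

Lemma quat_scalerAl (a : R) p q : a *: (p * q) = (a *: p) * q.
Proof. by apply: quat_eqP; split=> /=; ring. Qed.
HB.instance Definition _ :=
  GRing.Lmodule_isLalgebra.Build R (quat R) quat_scalerAl.

Lemma quat_scalerAr (a : R) p q : a *: (p * q) = p * (a *: q).
Proof. by apply: quat_eqP; split=> /=; ring. Qed.
HB.instance Definition _ :=
  GRing.Lalgebra_isAlgebra.Build R (quat R) quat_scalerAr.

Definition qdot p q := qre p * qre q + qi p * qi q + qj p * qj q + qk p * qk q.
Definition qnorm q := Num.sqrt (qdot q q).
Definition qconj q := Quat (qre q) (- qi q) (- qj q) (- qk q).

Lemma qdotqq_ge0 q : 0 <= qdot q q.
Proof. by rewrite /qdot; nra. Qed.

Lemma sqr_qnorm q : qnorm q ^+ 2 = qdot q q.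
Proof. by rewrite /qnorm sqr_sqrtr// qdotqq_ge0. Qed.

Lemma qdotqq_eq0 q : qdot q q = 0 -> q = 0.
Proof.
move=> q0; have [a b c d] : [/\ qre q ^+ 2 = 0, qi q ^+ 2 = 0, qj q ^+ 2 = 0
    & qk q ^+ 2 = 0].
  have := (sqr_ge0 (qre q), sqr_ge0 (qi q), sqr_ge0 (qj q), sqr_ge0 (qk q)).
  by move: q0; rewrite /qdot => q0 [[[? ?] ?] ?]; split; lra.
by apply: quat_eqP; split; apply/eqP; rewrite -sqrf_eq0; apply/eqP.
Qed.

Lemma qnorm_eq0 q : qnorm q = 0 -> q = 0.
Proof. by move=> q0; apply: qdotqq_eq0; rewrite -sqr_qnorm q0 expr0n. Qed.

Lemma qnormM p q : qnorm (p * q) = qnorm p * qnorm q.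
Proof.
rewrite /qnorm -sqrtrM ?qdotqq_ge0//; congr Num.sqrt.
by rewrite /qdot /=; ring.
Qed.

Lemma qnormZ (a : R) q : qnorm (a *: q) = `|a| * qnorm q.
Proof.
rewrite /qnorm (_ : qdot _ _ = a ^+ 2 * qdot q q); last by rewrite /qdot /=; ring.
by rewrite sqrtrM ?sqr_ge0// sqrtr_sqr.
Qed.

Lemma qdot_le p q : qdot p q <= qnorm p * qnorm q.
Proof.
have [pq0|/ltW pq0] := leP (qdot p q) 0.
  by rewrite (le_trans pq0)// mulr_ge0 ?sqrtr_ge0.
rewrite -(ler_pXn2r (ltn0Sn 1)) ?nnegrE ?mulr_ge0 ?sqrtr_ge0//.
rewrite exprMn !sqr_qnorm -subr_ge0 /qdot.
rewrite [leRHS](_ : _ =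
  (qre p * qi q - qi p * qre q) ^+ 2 + (qre p * qj q - qj p * qre q) ^+ 2 +
  (qre p * qk q - qk p * qre q) ^+ 2 + (qi p * qj q - qj p * qi q) ^+ 2 +
  (qi p * qk q - qk p * qi q) ^+ 2 + (qj p * qk q - qk p * qj q) ^+ 2).
  by rewrite !addr_ge0 ?sqr_ge0.
by ring.
Qed.

Lemma ler_qnormD p q : qnorm (p + q) <= qnorm p + qnorm q.
Proof.
rewrite -(ler_pXn2r (ltn0Sn 1)) ?nnegrE ?addr_ge0 ?sqrtr_ge0//.
have := qdot_le p q; rewrite sqrrD !sqr_qnorm.
by rewrite /qdot /=; nra.
Qed.

HB.instance Definition _ := @Lmodule_isNormed.Build R (quat R)
  qnorm ler_qnormD qnormZ qnorm_eq0.

Lemma quat_normE q : `|q| = qnorm q. Proof. by []. Qed.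

Lemma quat_normM p q : `|p * q| = `|p| * `|q|.
Proof. exact: qnormM. Qed.

Definition invq q := (qdot q q)^-1 *: qconj q.

Fact mulVq : {in [pred q | q != 0], left_inverse 1 invq *%R}.
Proof.
move=> q; rewrite inE => q0.
have n0 : qdot q q != 0 by apply: contra_neq q0; exact: qdotqq_eq0.
rewrite /invq -quat_scalerAl; apply: quat_eqP.
by split=> /=; move: n0; rewrite /qdot => n0; field.
Qed.

Fact mulqV : {in [pred q | q != 0], right_inverse 1 invq *%R}.
Proof.
move=> q; rewrite inE => q0.
have n0 : qdot q q != 0 by apply: contra_neq q0; exact: qdotqq_eq0.
rewrite /invq -quat_scalerAr; apply: quat_eqP.
by split=> /=; move: n0; rewrite /qdot => n0; field.
Qed.

Fact quat_unitP p q : q * p = 1 /\ p * q = 1 -> p \in [pred q | q != 0].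
Proof.
move=> [+ _]; rewrite inE; apply: contra_eqN => /eqP ->.
by rewrite mulr0 eq_sym oner_eq0.
Qed.

Fact invq_out : {in [predC [pred q | q != 0]], invq =1 id}.
Proof.
move=> q; rewrite !inE negbK => /eqP ->.
by apply: quat_eqP; split=> /=; ring.
Qed.

HB.instance Definition _ := @GRing.NzRing_hasMulInverse.Build (quat R)
  _ invq mulVq mulqV quat_unitP invq_out.

End QuatAlgebra.

(** Functions on [B(0, r)] are represented by total functions; their values
    outside [B(0, r)] are never used: the slices of the ball are relatively open,
    so that the partial derivatives below only depend on the values in the ball. *)

Section SliceRegular.
Variable R : realType.
Local Notation H := (quat R).
Implicit Types (r : R) (I J q z : H) (f g F G : H -> H).

Definition imag_sphere : set H := [set q | q ^+ 2 = -1].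

Definition slice I : set H := [set z | exists x y : R, z = x%:A + y *: I].

Definition slice_ball r I : set H := [set z | slice I z /\ `|z| < r].

(** At [z = x + y I], ['D_1 f z] and ['D_I f z] are the partial derivatives with
    respect to [x] and to [y] of [f (x + y I)]. *)
Definition slice_holomorphic r I f : Prop :=
  [/\ forall z, slice_ball r I z -> derivable f z 1 /\ derivable f z I,
      {within slice_ball r I, continuous ('D_1 f)},
      {within slice_ball r I, continuous ('D_I f)} &
      forall z, slice_ball r I z -> 2^-1 *: ('D_1 f z + I * 'D_I f z) = 0].

Definition slice_regular r f : Prop :=
  forall I, imag_sphere I -> slice_holomorphic r I f.

Definition slice_deriv f : H -> H := 'D_1 f.

(** Holomorphy of [F] and [G] needs no separate requirement: these conditions
    determine both functions on the slice [B_I] ([splitting_unique]), and they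
    are holomorphic there as soon as [g] is ([splitting_holomorphic]). *)
Definition splitting r I J g F G : Prop :=
  forall z, slice_ball r I z ->
    [/\ slice I (F z), slice I (G z) & g z = F z + G z * J].

Definition splitting_norm r I F G : \bar R :=
  sqrte (ereal_sup [set (`|F z| ^+ 2)%:E | z in slice_ball r I] +
         ereal_sup [set (`|G z| ^+ 2)%:E | z in slice_ball r I])%E.

(** The supremum is that of a singleton: [splitting_norm r I F G] does not depend
    on the choice of [J], [F], [G] ([slice_normE]), and such a choice exists
    ([imag_sphere_orth], [splitting_split]). *)
Definition slice_norm r I g : \bar R :=
  ereal_sup [set N | exists J F G,
    [/\ imag_sphere J, qdot I J = 0, splitting r I J g F G &
        N = splitting_norm r I F G]].

Definition regular_norm r g : \bar R :=
  ereal_sup [set slice_norm r I g | I in imag_sphere].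

Lemma imag_sphereP I :
  imag_sphere I <-> qre I = 0 /\ qi I ^+ 2 + qj I ^+ 2 + qk I ^+ 2 = 1.
Proof.
rewrite /imag_sphere /= expr2; case: I => a b c d /=; split.
  move=> [e0 e1 e2 e3].
  have a0 : a = 0.
    apply/eqP/negPn/negP => a0.
    have b0 : b = 0 by apply: (mulfI a0); lra.
    have c0 : c = 0 by apply: (mulfI a0); lra.
    have d0 : d = 0 by apply: (mulfI a0); lra.
    by have := sqr_ge0 a; rewrite b0 c0 d0 in e0; lra.
  by split=> //; rewrite a0 in e0; lra.
by move=> [-> e]; apply: quat_eqP; split=> /=; lra.
Qed.

Lemma imag_sphere_orth I : imag_sphere I ->
  exists2 J, imag_sphere J & qdot I J = 0.
Proof.
move=> /imag_sphereP; case: I => a b c d /= [a0 e].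
have [cd0|cd0] := eqVneq (c ^+ 2 + d ^+ 2) 0.
  have [c0 d0] : c ^+ 2 = 0 /\ d ^+ 2 = 0.
    by move: (sqr_ge0 c) (sqr_ge0 d) cd0 => *; split; lra.
  exists (Quat 0 0 1 0); first by apply/imag_sphereP => /=; split=> //; ring.
  by move/eqP: c0; rewrite sqrf_eq0 => /eqP c0; rewrite /qdot /= c0; ring.
have cdge0 : 0 <= c ^+ 2 + d ^+ 2 by rewrite addr_ge0 ?sqr_ge0.
have s0 : Num.sqrt (c ^+ 2 + d ^+ 2) != 0.
  by rewrite sqrtr_eq0 -ltNge lt_def cd0.
exists ((Num.sqrt (c ^+ 2 + d ^+ 2))^-1 *: Quat 0 0 d (- c)).
  apply/imag_sphereP; split=> /=; first by ring.
  rewrite mulr0 expr0n add0r !exprMn -mulrDr exprVn sqr_sqrtr// sqrrN.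
  by rewrite [X in _ * X]addrC mulVf.
by rewrite /qdot /=; ring.
Qed.

Lemma orth_mulC I J : imag_sphere I -> imag_sphere J -> qdot I J = 0 ->
  J * I = - (I * J).
Proof.
move=> /imag_sphereP[I0 _] /imag_sphereP[J0 _].
rewrite /qdot I0 J0 => IJ.
by apply: quat_eqP; rewrite /= I0 J0; split; lra.
Qed.

Lemma slice_comm I z : slice I z -> I * z = z * I.
Proof.
by move=> [x [y ->]]; rewrite mulrDr mulrDl -!scalerAl -!scalerAr mulr1 mul1r.
Qed.

Lemma imag_sphere_sqr I : imag_sphere I -> I * I = -1.
Proof. by rewrite /imag_sphere /= expr2. Qed.

Lemma imag_sphere_norm I : imag_sphere I -> `|I| = 1.
Proof.
move=> /imag_sphereP[I0 e]; rewrite quat_normE /qnorm /qdot I0.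
by rewrite mul0r add0r -!expr2 e sqrtr1.
Qed.

Lemma half_addK q : 2^-1 *: (q + q) = q.
Proof.
rewrite scalerDr -scalerDl -[RHS]scale1r; congr (_ *: _).
by field.
Qed.

Definition split1 I q : H := 2^-1 *: (q - I * q * I).
Definition split2 I J q : H := - (2^-1 *: (q + I * q * I)) * J.

Section Components.
Variables I J : H.
Hypotheses (SI : imag_sphere I) (SJ : imag_sphere J) (IJ : qdot I J = 0).

Lemma split_unique a b : slice I a -> slice I b ->
  a = split1 I (a + b * J) /\ b = split2 I J (a + b * J).
Proof.
move=> Ia Ib.
have e : I * (a + b * J) * I = - a + b * J.
  have ea : I * a * I = - a.
    by rewrite (slice_comm Ia) -mulrA (imag_sphere_sqr SI) mulrN1.
  have eb : I * (b * J) * I = b * J.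
    rewrite (mulrA I) (slice_comm Ib) -(mulrA (b * I)) (orth_mulC SI SJ IJ) mulrN.
    by rewrite mulrA -(mulrA b I) (imag_sphere_sqr SI) mulrN1 mulNr opprK.
  by rewrite mulrDr mulrDl ea eb.
split; first by rewrite /split1 e opprD opprK addrACA subrr addr0 half_addK.
rewrite /split2 e addrACA subrr add0r half_addK.
by rewrite mulNr -mulrA (imag_sphere_sqr SJ) mulrN1 opprK.
Qed.

Lemma comm_slice p : I * p = p * I -> slice I p.
Proof.
have [I0 eI] := (imag_sphereP I).1 SI => pI.
exists (qre p), (qi p * qi I + qj p * qj I + qk p * qk I).
have h1 := congr1 (@qi R) pI; have h2 := congr1 (@qj R) pI.
have h3 := congr1 (@qk R) pI.
apply: quat_eqP; move: h1 h2 h3; case: {pI} p => a b c d; rewrite /= I0.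
move: (qi I) (qj I) (qk I) eI => x y z eI h1 h2 h3.
have {}h1 : y * d = z * c by lra.
have {}h2 : z * b = x * d by lra.
have {}h3 : x * c = y * b by lra.
split; first by ring.
- rewrite mulr0 add0r -[LHS]mulr1 -eI.
  transitivity (b * x ^+ 2 + y * (y * b) + z * (z * b)); first by ring.
  by rewrite h2 -h3; ring.
- rewrite mulr0 add0r -[LHS]mulr1 -eI.
  transitivity (x * (x * c) + c * y ^+ 2 + z * (z * c)); first by ring.
  by rewrite h3 -h1; ring.
- rewrite mulr0 add0r -[LHS]mulr1 -eI.
  transitivity (x * (x * d) + y * (y * d) + d * z ^+ 2); first by ring.
  by rewrite -h2 h1; ring.
Qed.

Lemma split_slice q : slice I (split1 I q) /\ slice I (split2 I J q).
Proof.
have II := imag_sphere_sqr SI.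
have e1 : I * (I * q * I) = - (q * I) by rewrite !mulrA II !mulN1r mulNr.
have e2 : I * q * I * I = - (I * q) by rewrite -mulrA II mulrN1.
split; apply: comm_slice.
  rewrite /split1 -scalerAl -scalerAr mulrBl mulrBr e1 e2 !opprK.
  by rewrite addrC.
rewrite /split2 !mulNr mulrN; congr (- _); set Y := _ *: _.
have IY : I * Y = - (Y * I).
  rewrite /Y -scalerAl -scalerAr -scalerN; congr (_ *: _).
  by rewrite mulrDl mulrDr e1 e2 opprD opprK addrC.
by rewrite -(mulrA Y) (orth_mulC SI SJ IJ) mulrN !mulrA IY mulNr.
Qed.

Lemma split_eq q : q = split1 I q + split2 I J q * J.
Proof.
rewrite /split1 /split2 -(mulrA _ J J) (imag_sphere_sqr SJ) mulrN1 opprK -scalerDr.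
by rewrite addrACA addNr addr0 half_addK.
Qed.

End Components.

Lemma splitting_split r I J g : imag_sphere I -> imag_sphere J ->
  qdot I J = 0 -> splitting r I J g (split1 I \o g) (split2 I J \o g).
Proof.
move=> SI SJ IJ z _ /=.
by have [s1 s2] := split_slice SI SJ IJ (g z); split=> //; exact: split_eq.
Qed.

Lemma splitting_unique r I J g F G : imag_sphere I -> imag_sphere J ->
  qdot I J = 0 -> splitting r I J g F G ->
  {in slice_ball r I, F =1 split1 I \o g} /\
  {in slice_ball r I, G =1 split2 I J \o g}.
Proof.
move=> SI SJ IJ FG; split=> z; rewrite inE => /FG[Fz Gz /= ->];
  by have [] := split_unique SI SJ IJ Fz Gz.
Qed.

Lemma norm_split2 I J J' q : imag_sphere J -> imag_sphere J' ->
  `|split2 I J q| = `|split2 I J' q|.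
Proof.
by move=> SJ SJ'; rewrite /split2 !quat_normM !(imag_sphere_norm SJ, imag_sphere_norm SJ').
Qed.

Lemma slice_normE r I J g F G : imag_sphere I -> imag_sphere J ->
  qdot I J = 0 -> splitting r I J g F G ->
  slice_norm r I g = splitting_norm r I F G.
Proof.
move=> SI SJ IJ FG; rewrite /slice_norm.
rewrite [X in ereal_sup X](_ : _ = [set splitting_norm r I F G]) ?ereal_sup1//.
apply/seteqP; split=> [_ [J' [F' [G' [SJ' IJ' FG' ->]]]]|_ ->]; last first.
  by exists J, F, G.
have [eF eG] := splitting_unique SI SJ IJ FG.
have [eF' eG'] := splitting_unique SI SJ' IJ' FG'.
rewrite /splitting_norm /=; congr (sqrte (ereal_sup _ + ereal_sup _)%E);
  apply: eq_imagel => z zI.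
- by rewrite eF ?eF' ?inE.
- by rewrite eG ?eG' ?inE//= (@norm_split2 I J' J).
Qed.


Section Postcomposition.
Variables (I : H) (L : {linear H -> H}).
Hypotheses (LI : forall q, L (I * q) = I * L q) (M : R)
  (LM : forall q, `|L q| <= M * `|q|).

Lemma postcomp_continuous : continuous L.
Proof.
apply/linear_bounded_continuous/linear_boundedP; near=> e => x.
rewrite (le_trans (LM x))// ler_wpM2r//.
Unshelve. all: end_near. Qed.

Lemma slice_ball_near r z v : slice_ball r I z -> slice I v ->
  \forall h \near 0^', slice_ball r I (h *: v + z).
Proof.
move=> [[x [y ze]] zr] [a [b ve]].
have c : (fun h : R => `|h *: v + z|) @ 0^' --> `|z|.
  have -> : `|z| = `|0 *: v + z| by rewrite scale0r add0r.
  apply: cvg_norm; apply: cvgD; last exact: cvg_cst.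
  by apply: cvgZr_tmp; apply: (cvg_within_filter (f := id)); exact: cvg_id.
have hr : \forall h \near (0 : R)^', `|h *: v + z| < r.
  exact: (cvgr_lt _ c _ zr).
apply: filterS hr => h hr.
split=> //; exists (h * a + x), (h * b + y).
by rewrite ve ze scalerDr !scalerA addrACA -!scalerDl.
Qed.

Lemma postcomp_derive r f F z v :
  {in slice_ball r I, F =1 L \o f} -> slice_ball r I z -> slice I v ->
  derivable f z v -> derivable F z v /\ 'D_v F z = L ('D_v f z).
Proof.
move=> FE zI vI df.
suff c : (fun h => h^-1 *: ((F \o shift z) (h *: v) - F z)) @ 0^' -->
    L ('D_v f z).
  by split; [apply/cvg_ex; exists (L ('D_v f z)) | exact: cvg_lim c].
have Lc := cvg_comp _ _ df (@postcomp_continuous ('D_v f z)).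
apply: cvg_trans Lc; apply: near_eq_cvg; apply: filterS (slice_ball_near zI vI) => h hI /=.
by rewrite !FE ?inE//= linearZ linearB.
Qed.

Lemma postcomp_holomorphic r f F : {in slice_ball r I, F =1 L \o f} ->
  slice_holomorphic r I f -> slice_holomorphic r I F.
Proof.
move=> FE [df c1 cI CR].
have s1 : slice I 1 by exists 1, 0; rewrite scale0r addr0 scale1r.
have sI : slice I I by exists 0, 1; rewrite scale0r add0r scale1r.
have e1 z (zI : slice_ball r I z) := postcomp_derive FE zI s1 (df z zI).1.
have eI z (zI : slice_ball r I z) := postcomp_derive FE zI sI (df z zI).2.
split=> [z zI| | |z zI].
- by split; [case: (e1 z zI) | case: (eI z zI)].
- apply: (@subspace_eq_continuous _ (slice_ball r I) _ (L \o 'D_1 f)).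
    by move=> z; rewrite inE => zI /=; case: (e1 z zI).
  move=> z; exact: (@continuous_comp (subspace (slice_ball r I)) H H ('D_1 f) L z
    (@c1 z) (@postcomp_continuous _)).
- apply: (@subspace_eq_continuous _ (slice_ball r I) _ (L \o 'D_I f)).
    by move=> z; rewrite inE => zI /=; case: (eI z zI).
  move=> z; exact: (@continuous_comp (subspace (slice_ball r I)) H H ('D_I f) L z
    (@cI z) (@postcomp_continuous _)).
- by rewrite (e1 z zI).2 (eI z zI).2 -LI -linearD -linearZ CR// linear0.
Qed.

End Postcomposition.

Lemma split1_is_linear I : linear (split1 I).
Proof.
move=> a p q; rewrite /split1 mulrDr mulrDl -scalerAr -scalerAl opprD addrACA.
by rewrite -scalerBr scalerDr !scalerA mulrC.
Qed.
HB.instance Definition _ I := GRing.isLinear.Build R H H _ (split1 I)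
  (split1_is_linear I).

Lemma split2_is_linear I J : linear (split2 I J).
Proof.
move=> a p q; rewrite /split2 !mulNr -!mulrN.
have -> : a *: p + q + I * (a *: p + q) * I =
    a *: (p + I * p * I) + (q + I * q * I).
  by rewrite mulrDr mulrDl -scalerAr -scalerAl addrACA scalerDr.
by rewrite scalerDr mulrDl scalerAl !scalerA [_ * a]mulrC.
Qed.
HB.instance Definition _ I J := GRing.isLinear.Build R H H _ (split2 I J)
  (split2_is_linear I J).

Lemma splitting_holomorphic r I J g F G : imag_sphere I -> imag_sphere J ->
  qdot I J = 0 -> splitting r I J g F G -> slice_holomorphic r I g ->
  slice_holomorphic r I F /\ slice_holomorphic r I G.
Proof.
move=> SI SJ IJ FG hg; have [eF eG] := splitting_unique SI SJ IJ FG.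
have II := imag_sphere_sqr SI.
have IqI q : `|I * q * I| = `|q|.
  by rewrite !quat_normM (imag_sphere_norm SI) mul1r mulr1.
have n2 : `|2^-1 : R| = 2^-1 by rewrite ger0_norm.
split.
- apply: (@postcomp_holomorphic I (split1 I) _ 1 _ _ _ _ eF hg) => q /=.
    rewrite /split1 -scalerAr mulrBr; congr (_ *: (_ - _)).
    by rewrite !mulrA.
  rewrite /split1 normrZ n2 mul1r (le_trans (ler_wpM2l _ (ler_normB _ _)))//.
  by rewrite IqI; lra.
- apply: (@postcomp_holomorphic I (split2 I J) _ 1 _ _ _ _ eG hg) => q /=.
    rewrite /split2 !mulNr mulrN; congr (- _).
    by rewrite [RHS]mulrA -scalerAr mulrDr !mulrA.
  rewrite /split2 quat_normM normrN normrZ n2 (imag_sphere_norm SJ) mulr1 mul1r.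
  rewrite (le_trans (ler_wpM2l _ (ler_normD _ _)))//.
  by rewrite IqI; lra.
Qed.

End SliceRegular.

(* Main.v *)
(** On the slice of [q], the Cauchy-Riemann equation says that the derivative of
    [t |-> q^-1 * f (t q)] is ['D_1 f (t q)].  The mean value theorem, applied to
    the component along [w = q^-1 * f q], yields a point [z = s q] with
    [|w| <= |'D_1 f z|], and [|F z|^2 + |G z|^2 = |'D_1 f z|^2] for any splitting
    [F + G J] of ['D_1 f], so that even [|w| <= ||'D_1 f||_I]. *)

Require Import Defs.
From mathcomp Require Import all_boot all_order all_algebra.
From mathcomp Require Import ring lra.
From mathcomp Require Import all_classical all_reals all_analysis.
Import Order.TTheory GRing.Theory Num.Theory.
Import numFieldNormedType.Exports.
Local Open Scope ring_scope.

(** * Mean value theorem and chain rule in two real variables *)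

Section RealCalculus.
Variable R : realType.
Local Open Scope classical_set_scope.
Local Open Scope ring_scope.

(** Both difference quotients are the same function of [h], so derivability and the value of the
    derivative transfer together. *)
Lemma is_derive_line {V W : normedModType R} (g : V -> W) (p v : V) (s : R) :
  derivable g (p + s *: v) v ->
  is_derive s 1 (fun t : R => g (p + t *: v)) ('D_v g (p + s *: v)).
Proof.
move=> dg.
have e : (fun h : R => h^-1 *: (((fun t : R => g (p + t *: v)) \o shift s) (h *: 1)
      - g (p + s *: v))) =
    (fun h => h^-1 *: ((g \o shift (p + s *: v)) (h *: v) - g (p + s *: v))).
  apply/funext => h /=; congr (_ *: (g _ - _)).
  by rewrite [h *: 1]mulr1 scalerDl addrCA.
by split; rewrite /derivable /derive e.
Qed.

(** Absolute values let [x] and [y] come in either order: below, the increment [h * b] may have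
    either sign. *)
Lemma MVT_between (k dk : R -> R) (x y : R) :
  (forall s : R, `|s - x| <= `|y - x| -> is_derive s 1 k (dk s)) ->
  exists2 c : R, `|c - x| <= `|y - x| & k y - k x = dk c * (y - x).
Proof.
move=> dk_near.
have mvt (a b : R) : a <= b ->
    (forall s : R, a <= s <= b -> is_derive s 1 k (dk s)) ->
    exists2 c : R, a <= c <= b & k b - k a = dk c * (b - a).
  move=> ab dkab.
  have [||c] := @MVT_segment R k dk a b ab; last by rewrite in_itv/=; exists c.
    by move=> s; rewrite in_itv/= => /andP[? ?]; apply: dkab; rewrite !ltW.
  apply: continuous_in_subspaceT => s; rewrite inE/= in_itv/= => /dkab ds.
  by apply/differentiable_continuous/derivable1_diffP; exact: ex_derive.
have [xy|/ltW yx] := leP x y.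
  have [s /andP[xs sy]|c /andP[xc cy] E] := mvt x y xy.
    by apply: dk_near; rewrite !ger0_norm ?subr_ge0// lerB.
  by exists c => //; rewrite !ger0_norm ?subr_ge0// lerB.
have [s /andP[ys sx]|c /andP[yc cx] E] := mvt y x yx.
  by apply: dk_near; rewrite !ler0_norm ?subr_le0// lerN2 lerB.
exists c; first by rewrite !ler0_norm ?subr_le0// lerN2 lerB.
by rewrite -opprB E -mulrN opprB.
Qed.

(* Only one of the two partial derivatives has to be continuous: the increment
   in the other variable is taken at a fixed value of the first one. *)
Lemma is_derive_partials (G Gy : R -> R -> R) (a b t da : R) :
  is_derive (t * a) 1 (G^~ (t * b)) da ->
  (\forall p \near (t * a, t * b), is_derive (p.2 : R) 1 (G p.1) (Gy p.1 p.2)) ->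
  {for (t * a, t * b), continuous (fun p => Gy p.1 p.2)} ->
  is_derive t 1 (fun s => G (s * a) (s * b)) (da * a + Gy (t * a) (t * b) * b).
Proof.
move=> Gx Gyd Gyc.
have lin (c s : R) : is_derive s 1 (fun u => u * c) c.
  have -> : (fun u => u * c) = c \*: id by apply/funext => u /=; rewrite mulrC.
  apply: is_derive_eq; exact: mulr1.
have d1 := @is_derive1_comp R (G^~ (t * b)) ( *%R^~ a) t _ _ Gx (lin a t).
(* [d1] moves only the first variable. The remaining difference vanishes at [s = t], and by the mean
   value theorem its quotient at [h] is [Gy ((h + t) * a) c * b] with [c] between [t * b] and
   [(h + t) * b]. *)
have d2 : is_derive t 1 (fun s => G (s * a) (s * b) - G (s * a) (t * b))
    (Gy (t * a) (t * b) * b).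
  suff c : (fun h : R => h^-1 *:
      (((fun s => G (s * a) (s * b) - G (s * a) (t * b)) \o shift t) (h *: 1)
        - (G (t * a) (t * b) - G (t * a) (t * b)))) @ 0^'
      --> Gy (t * a) (t * b) * b.
    by split; [apply/cvg_ex; exists (Gy (t * a) (t * b) * b) | exact: cvg_lim c].
  apply/cvgrPdist_le => eps eps0.
  have b1 : 0 < `|b| + 1 by rewrite ltr_wpDl.
  have eta0 : 0 < eps / (`|b| + 1) by rewrite divr_gt0.
  have /cvgrPdist_le/(_ _ eta0) Hc := Gyc.
  have [d /= d0 Hd] := (nbhs_ballP _ _).1 (filterI Gyd Hc).
  (* When [h] times this constant stays below [d] in absolute value, both coordinates move by less
     than [d]; the summand 1 covers [a = b = 0]. *)
  have m1 : 0 < `|a| + `|b| + 1 by rewrite ltr_wpDl ?addr_ge0.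
  exists (d / (`|a| + `|b| + 1)) => /=; first by rewrite divr_gt0.
  move=> h /=; rewrite sub0r normrN ltr_pdivlMr// => hd h0.
  have inb (s : R) : `|s - t * b| <= `|(h + t) * b - t * b| ->
      ball (t * a, t * b) d ((h + t) * a, s).
    rewrite -mulrBl addrK normrM => sh; split; rewrite /ball /= distrC.
      rewrite -mulrBl addrK normrM (le_lt_trans _ hd)// ler_wpM2l//.
      by rewrite -addrA lerDl addr_ge0.
    rewrite (le_lt_trans sh)// (le_lt_trans _ hd)// ler_wpM2l//.
    by rewrite -addrA addrCA lerDl addr_ge0.
  have [c cb E] := MVT_between (G ((h + t) * a)) (Gy ((h + t) * a)) (t * b)
    ((h + t) * b) (fun s sh => (Hd _ (inb s sh)).1).
  rewrite [h *: 1]mulr1 subrr subr0 E -mulrBl addrK.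
  have -> : h^-1 *: (Gy ((h + t) * a) c * (h * b)) = Gy ((h + t) * a) c * b.
    by rewrite /GRing.scale /=; field.
  have := (Hd _ (inb c cb)).2; rewrite /= ler_pdivlMr// => Hle.
  by rewrite -mulrBl normrM (le_trans _ Hle)// ler_wpM2l// lerDl.
have := is_deriveD d2 d1.
rewrite [X in is_derive _ _ _ X]addrC; congr (is_derive _ _ _ _).
by apply/funext => s; exact: subrK.
Qed.

End RealCalculus.

(** * Slice derivatives along rays, and the norm of a splitting *)

Section Quaternions.
Variable R : realType.
Local Open Scope classical_set_scope.
Local Open Scope ring_scope.
Local Notation H := (quat R).
Implicit Types (r a b t : R) (I J u p q z v : H) (f g F G : H -> H).

Lemma qdotB u p q : qdot u (p - q) = qdot u p - qdot u q.
Proof. by rewrite /qdot /=; ring. Qed.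

Lemma qdotZ u a p : qdot u (a *: p) = a * qdot u p.
Proof. by rewrite /qdot /=; ring. Qed.

Lemma qdotD u p q : qdot u (p + q) = qdot u p + qdot u q.
Proof. by rewrite /qdot /=; ring. Qed.

Lemma continuous_qdot u : continuous (qdot u).
Proof.
move=> p; apply/(@cvgrPdist_le _ _ _ (nbhs p)) => e e0.
have u1 : 0 < `|u| + 1 by rewrite ltr_wpDl.
have n : qnorm (- u) = qnorm u by rewrite -!quat_normE normrN.
have eu0 : 0 < e / (`|u| + 1) by rewrite divr_gt0.
have /cvgrPdist_le/(_ _ eu0) := @cvg_id _ (nbhs p).
apply: filterS => q; rewrite -qdotB.
rewrite ler_pdivlMr// mulrC => pqe; apply: le_trans pqe.
rewrite (@le_trans _ _ (`|u| * `|p - q|))//; last by rewrite ler_wpM2r// lerDl.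
(* Cauchy-Schwarz in [qdot_le] is one-sided; the lower bound is its instance at [- u]. *)
rewrite ler_norml; apply/andP; split; last exact: qdot_le.
rewrite lerNl; have := qdot_le (- u) (p - q).
by rewrite n; congr (_ <= _); rewrite /qdot /=; ring.
Qed.

(** Pairing with a fixed [u] gives real-valued functions, to which the mean value theorem applies;
    it commutes with the limit because it is linear and continuous. *)
Lemma qdot_derive u f z v : derivable f z v ->
  derivable (qdot u \o f) z v /\ 'D_v (qdot u \o f) z = qdot u ('D_v f z).
Proof.
move=> df.
suff c : (fun h => h^-1 *: (((qdot u \o f) \o shift z) (h *: v) - (qdot u \o f) z))
    @ 0^' --> qdot u ('D_v f z).
  by split; [apply/cvg_ex; exists (qdot u ('D_v f z)) | exact: cvg_lim c].
have := cvg_comp _ _ df (@continuous_qdot u ('D_v f z)).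
by apply: cvg_trans; apply: near_eq_cvg; near=> h; rewrite /= qdotZ qdotB.
Unshelve. all: end_near. Qed.

Lemma slice_point_continuous I :
  continuous (fun p : R * R => p.1%:A + p.2 *: I : H).
Proof.
move=> p; apply: cvgD; apply: cvgZr_tmp; [exact: cvg_fst | exact: cvg_snd].
Qed.

(* The chain rule along the ray through [q]; the Cauchy-Riemann equation turns
   [a * 'D_1 f + b * 'D_I f] into [(a + b I) * 'D_1 f]. *)
Lemma slice_holomorphic_ray r I f u q t : imag_sphere I ->
  slice_holomorphic r I f -> slice I q -> `|t *: q| < r ->
  is_derive t 1 (fun s : R => qdot u (f (s *: q))) (qdot u (q * 'D_1 f (t *: q))).
Proof.
move=> SI [df _ cI CR] [a [b ->]].
have ptE s : s *: (a%:A + b *: I) = (s * a)%:A + (s * b) *: I :> H.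
  by rewrite scalerDr !scalerA.
rewrite ptE => tr; set z := _ + _ in tr *.
have zI : slice_ball r I z by split=> //; exists (t * a), (t * b).
have near_ball : \forall p \near (t * a, t * b),
    slice_ball r I (p.1%:A + p.2 *: I).
  have c : `|p.1%:A + p.2 *: I : H| @[p --> (t * a, t * b)] --> `|z|.
    by apply: cvg_norm; exact: (@slice_point_continuous I (t * a, t * b)).
  apply: filterS (cvgr_lt _ c _ tr) => p pr.
  by split=> //; exists p.1, p.2.
have dx : is_derive (t * a) 1 (fun x => qdot u (f (x%:A + (t * b) *: I)))
    (qdot u ('D_1 f z)).
  have [] := qdot_derive u _ _ _ (df z zI).1.
  rewrite /z addrC => d1 d2.
  have := is_derive_line _ _ _ _ _ d1; rewrite d2.
  by congr (is_derive _ _ _ _); apply/funext => x /=; rewrite addrC.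
have dy : \forall p \near (t * a, t * b), is_derive (p.2 : R) 1
    (fun y => qdot u (f (p.1%:A + y *: I)))
    (qdot u ('D_I f (p.1%:A + p.2 *: I))).
  apply: filterS near_ball => p pI.
  have [d1 d2] := qdot_derive u _ _ _ (df _ pI).2.
  by have := is_derive_line _ _ _ _ _ d1; rewrite d2.
have cy : {for (t * a, t * b), continuous
    (fun p : R * R => qdot u ('D_I f (p.1%:A + p.2 *: I)))}.
  apply: continuous_comp; last exact: continuous_qdot.
  (* Continuity within the slice ball becomes plain continuity in the two real coordinates, since
     all nearby parameters land in the ball. *)
  have /subspace_continuousP/(_ _ zI) c := cI.
  apply: cvg_trans c => A; rewrite /nbhs /= => A0.
  have := @slice_point_continuous I (t * a, t * b) _ A0.
  by apply: filterS2 near_ball => p pI; apply.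
have := @is_derive_partials R (fun x y => qdot u (f (x%:A + y *: I)))
  (fun x y => qdot u ('D_I f (x%:A + y *: I))) a b t _ dx dy cy.
congr (is_derive _ _ _ _); first by apply/funext => s; rewrite ptE.
rewrite -/z (mulrDl a%:A) -(scalerAl a 1) -(scalerAl b I) mul1r qdotD !qdotZ.
rewrite mulrC [_ * b]mulrC; congr (_ + _ * qdot u _).
have /eqP := CR z zI; rewrite scaler_eq0 invr_eq0 pnatr_eq0/= addr_eq0 => /eqP ->.
by rewrite mulrN mulrA (imag_sphere_sqr SI) mulN1r opprK.
Qed.

(** The unit is the normalised imaginary part of [q]; a real [q] lies on every slice, so
    [Quat 0 1 0 0] serves. *)
Lemma slice_cover q : exists2 I, imag_sphere I & slice I q.
Proof.
case: q => x y z w.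
have [e|e] := eqVneq (y ^+ 2 + z ^+ 2 + w ^+ 2) 0.
  have [y0 z0 w0] : [/\ y ^+ 2 = 0, z ^+ 2 = 0 & w ^+ 2 = 0].
    by have := (sqr_ge0 y, sqr_ge0 z, sqr_ge0 w) => -[[? ?] ?]; split; lra.
  exists (Quat 0 1 0 0); first by apply/imag_sphereP => /=; split=> //; ring.
  exists x, 0; apply: quat_eqP => /=.
  move/eqP: y0; rewrite sqrf_eq0 => /eqP ->.
  move/eqP: z0; rewrite sqrf_eq0 => /eqP ->.
  move/eqP: w0; rewrite sqrf_eq0 => /eqP ->.
  by split; ring.
have ege0 : 0 <= y ^+ 2 + z ^+ 2 + w ^+ 2 by rewrite !addr_ge0 ?sqr_ge0.
set s := Num.sqrt (y ^+ 2 + z ^+ 2 + w ^+ 2).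
have s0 : s != 0 by rewrite sqrtr_eq0 -ltNge lt_def e.
exists (s^-1 *: Quat 0 y z w).
  apply/imag_sphereP; split=> /=; first by ring.
  by rewrite !exprMn -!mulrDr exprVn sqr_sqrtr// mulVf.
by exists x, s; apply: quat_eqP; split=> /=; field.
Qed.

(* Mean value theorem for the component of [q^-1 * f (t q)] along [q^-1 * f q]. *)
Lemma slice_mean_value r I f q : imag_sphere I -> slice_holomorphic r I f ->
  f 0 = 0 -> slice_ball r I q -> q != 0 ->
  exists2 z, slice_ball r I z & `|q^-1 * f q| <= `|'D_1 f z|.
Proof.
move=> SI hf f0 [qI qr] q0.
set w := q^-1 * f q.
have [w0|w0] := eqVneq w 0.
  by exists q; rewrite // w0 normr0 normr_ge0.
(* Left multiplication by [qconj q^-1] is adjoint to left multiplication by [q^-1]. Pairing [f] with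
   [u] thus takes the component of [q^-1 * f] along [w], and the factor [q] from the ray derivative
   cancels. *)
pose u := qconj q^-1 * w.
have adj p : qdot u p = qdot w (q^-1 * p) by rewrite /qdot /=; ring.
have q1 : q \is a GRing.unit by [].
have tq (t : R) : `|t| <= 1 -> slice_ball r I (t *: q).
  move=> t1; split; last by rewrite normrZ (le_lt_trans _ qr)// ler_piMl.
  by case: qI => a [b ->]; exists (t * a), (t * b); rewrite scalerDr !scalerA.
have [s] : exists2 s : R, `|s - 0| <= `|1 - 0| &
    qdot u (f (1 *: q)) - qdot u (f (0 *: q)) =
    qdot u (q * 'D_1 f (s *: q)) * (1 - 0).
  apply: (MVT_between _ (fun t => qdot u (f (t *: q)))
    (fun t => qdot u (q * 'D_1 f (t *: q)))) => s.
  rewrite !subr0 normr1 => /tq[_ s1].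
  exact: slice_holomorphic_ray SI hf qI s1.
rewrite !subr0 normr1 => /tq sI.
rewrite scale1r scale0r f0 mulr1 !adj mulr0 mulKr// -/w => E.
exists (s *: q) => //.
have w1 : 0 < `|w| by rewrite normr_gt0.
(* After multiplication by [|w|], the left side is [qdot w w], which [E] equates with
   [qdot w ('D_1 f (s *: q))]; Cauchy-Schwarz concludes. *)
rewrite -(ler_pM2l w1) -expr2 quat_normE sqr_qnorm -(quat_normE w).
have -> : qdot w w = qdot w ('D_1 f (s *: q)) by rewrite -E -qdotB subr0.
exact: qdot_le.
Qed.

(** [F z] and [G z * J] are orthogonal, so Pythagoras splits [|g z| ^+ 2] into two squares, each
    below its own supremum. *)
Lemma splitting_norm_ge r I J g F G z : imag_sphere I -> imag_sphere J ->
  qdot I J = 0 -> splitting r I J g F G -> slice_ball r I z ->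
  (`|g z|%:E <= splitting_norm r I F G)%E.
Proof.
move=> SI SJ IJ FG zI; have [[a [b Fz]] [c [d Gz]] gz] := FG z zI.
have pyth : `|g z| ^+ 2 = `|F z| ^+ 2 + `|G z| ^+ 2.
  have [[I0 _] [J0 _]] := ((imag_sphereP I).1 SI, (imag_sphereP J).1 SJ).
  have GJ : `|G z * J| = `|G z| by rewrite quat_normM (imag_sphere_norm SJ) mulr1.
  rewrite gz -GJ !quat_normE !sqr_qnorm.
  suff o : qdot (F z) (G z * J) = 0.
    by move: o; rewrite /qdot /= => o; lra.
  (* With [F z = a + b I] and [G z = c + d I], the product is [(b c - a d)] times [qdot I J],
     because the real part of [I * J] is [- qdot I J]. *)
  rewrite Fz Gz -[RHS](mulr0 (b * c - a * d)) -IJ /qdot /= I0 J0.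
  by ring.
rewrite -(normr_id (g z)) -sqrtr_sqr /splitting_norm.
have -> : (Num.sqrt (`|g z| ^+ 2))%:E = sqrte (`|g z| ^+ 2)%:E by [].
have supF : ((`|F z| ^+ 2)%:E <=
    ereal_sup [set (`|F x| ^+ 2)%:E | x in slice_ball r I])%E.
  by apply: ereal_sup_ubound; exists z.
have supG : ((`|G z| ^+ 2)%:E <=
    ereal_sup [set (`|G x| ^+ 2)%:E | x in slice_ball r I])%E.
  by apply: ereal_sup_ubound; exists z.
rewrite lee_sqrt; first by rewrite pyth EFinD; exact: leeD.
apply: adde_ge0; [apply: le_trans supF|apply: le_trans supG];
  by rewrite lee_fin sqr_ge0.
Qed.

End Quaternions.

Theorem theorem4p4 (R : realType) (r : R) (f : quat R -> quat R) :
  0 < r -> slice_regular r f -> f 0 = 0 ->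
  forall q : quat R, `|q| < r -> q != 0 ->
    (`|q^-1 * f q|%:E <= regular_norm r (slice_deriv f))%E.
Proof.
move=> _ rf f0 q qr q0.
have [I SI qI] := slice_cover _ q.
have [J SJ IJ] := imag_sphere_orth SI.
have [z zI qz] := slice_mean_value _ _ _ _ _ SI (rf I SI) f0 (conj qI qr) q0.
have FG := @splitting_split _ r I J (slice_deriv f) SI SJ IJ.
apply: (@le_trans _ _ (slice_norm r I (slice_deriv f))); last first.
  by apply: ereal_sup_ubound; exists I.
rewrite (slice_normE SI SJ IJ FG).
apply: (le_trans _ (splitting_norm_ge _ _ _ _ _ _ _ _ SI SJ IJ FG zI)).
by rewrite lee_fin.
Qed.
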